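(* Let $n\ge 2$ and $d\ge 1$ be integers and $d_0=\lceil d/2\rceil$. With the sets $\mathcal{H}[\overline{\Delta}]_k\subseteq\mathbb{R}^{\overline{\mathbb{N}}_d^n}$, the cones $\mathcal{CP}_{n,d}$, $\mathcal{CP}_n^{\otimes d}$ and the isomorphism $\phi$ defined in the context, one has $$\bigcap_{k\ge d_0}\mathcal{H}[\overline{\Delta}]_k=\mathcal{CP}_{n,d},\qquad \bigcap_{k\ge d_0}\phi^{-1}\big(\mathcal{H}[\overline{\Delta}]_k\big)=\mathcal{CP}_n^{\otimes d}.$$
   Context: Write $x=(x_1,\dots,x_n)$, $\bar n=n-1$, $\bar x=(x_1,\dots,x_{n-1})$; $e$ denotes the all-ones vector of appropriate length. For $\alpha\in\mathbb{N}^m$ let $|\alpha|=\alpha_1+\cdots+\alpha_m$; $\mathbb{N}_d^m=\{\alpha\in\mathbb{N}^m:|\alpha|\le d\}$ and $\overline{\mathbb{N}}_d^n=\{\alpha\in\mathbb{N}^n:|\alpha|=d\}$. $\mathbb{R}^{\mathbb{N}_d^{\bar n}}$ and $\mathbb{R}^{\overline{\mathbb{N}}_d^n}$ are the spaces of real vectors labelled by these sets. For $u\in\mathbb{R}^n$, $[u]_d^{\mathrm{hom}}=(u^\alpha)_{\alpha\in\overline{\mathbb{N}}_d^n}$. A vector labelled by multi-indices acts on polynomials by $\langle\sum_\alpha p_\alpha x^\alpha,y\rangle=\sum_\alpha p_\alpha y_\alpha$ (and likewise for polynomials in $\bar x$). CP cones: $\mathtt{S}^d(\mathbb{R}^n)$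 is the space of real symmetric tensors of order $d$ over $\mathbb{R}^n$; for $v\in\mathbb{R}^n$, $(v^{\otimes d})_{i_1\ldots i_d}=v_{i_1}\cdots v_{i_d}$. $\mathcal{CP}_n^{\otimes d}\subseteq\mathtt{S}^d(\mathbb{R}^n)$ is the cone of completely positive (CP) tensors, i.e. finite sums $\sum_i (v_i)^{\otimes d}$ with $v_i\in\mathbb{R}^n_+$. $\mathcal{CP}_{n,d}\subseteq\mathbb{R}^{\overline{\mathbb{N}}_d^n}$ is the cone of finite sums $\sum_i[u_i]_d^{\mathrm{hom}}$ with $u_i\in\mathbb{R}_+^n$. The linear isomorphism $\phi:\mathtt{S}^d(\mathbb{R}^n)\to\mathbb{R}^{\overline{\mathbb{N}}_d^n}$ is $\phi(\mathcal{A})_\alpha=\mathcal{A}_{i_1\ldots i_d}$ whenever $x^\alpha=x_{i_1}\cdots x_{i_d}$. Dehomogenization: $\varpi$ maps a form $f$ of degree $d$ in $x$ to $\varpi(f)=f(\bar x,1-e^T\bar x)\in\mathbb{R}[\bar x]_d$; it is a linear isomorphism, and its inverse adjoint $\varpi^{-T}:\mathbb{R}^{\overline{\mathbb{N}}_d^n}\to\mathbb{R}^{\mathbb{N}_d^{\bar n}}$ is given by $(\varpi^{-T}(y))_\alpha=\langle\bar x^\alpha(e^Tx)^{d-|\alpha|},y\rangle$ for $\alpha\in\mathbb{N}_d^{\bar n}$. Moment relaxations: $\overline{\Delta}=\{\bar x\in\mathbb{R}^{\bar n}:\bar x\ge0,\ 1-e^T\bar x\ge 0\}$ (for which the constraint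 $1-\|\bar x\|^2\ge0$ is redundant). For $z\in\mathbb{R}^{\mathbb{N}_{2k}^{\bar n}}$ and $q\in\mathbb{R}[\bar x]_{2k}$, the $k$th order localizing matrix $L_q^{(k)}[z]$ is the symmetric matrix, indexed by monomials of degree at most $k-\lceil\deg(q)/2\rceil$, with $\langle qa^2,z\rangle=\mathrm{vec}(a)^TL_q^{(k)}[z]\,\mathrm{vec}(a)$ for all $a\in\mathbb{R}[\bar x]$ with $\deg(qa^2)\le 2k$, where $\mathrm{vec}(a)$ is the coefficient vector of $a$; $M_k[z]=L_1^{(k)}[z]$. Let $\mathcal{S}[\overline{\Delta}]_{2k}$ be the set of $z\in\mathbb{R}^{\mathbb{N}_{2k}^{\bar n}}$ with $M_k[z]\succeq0$, $L_{x_i}^{(k)}[z]\succeq0$ ($i=1,\dots,n-1$), $L_{1-e^T\bar x}^{(k)}[z]\succeq0$ and $L_{1-\|\bar x\|^2}^{(k)}[z]\succeq0$. For $k\ge d_0$ define $$\mathcal{F}[\overline{\Delta}]_k=\{y\in\mathbb{R}^{\mathbb{N}_d^{\bar n}}:\exists z\in\mathcal{S}[\overline{\Delta}]_{2k},\ y_\alpha=z_\alpha\ (\alpha\in\mathbb{N}_d^{\bar n})\},\qquad \mathcal{H}[\overline{\Delta}]_k=\{y\in\mathbb{R}^{\overline{\mathbb{N}}_d^n}:\varpi^{-T}(y)\in\mathcal{F}[\overline{\Delta}]_k\}.$$ *)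

(* Defs.v *)
From HB Require Import structures.
From mathcomp Require Import all_boot all_order all_fingroup all_algebra.
From mathcomp Require Import boolp classical_sets reals.
From mathcomp Require Import mpoly.

Set Implicit Arguments.
Unset Strict Implicit.
Unset Printing Implicit Defensive.

Import Order.TTheory GRing.Theory Num.Theory.

Local Open Scope ring_scope.
Local Open Scope classical_set_scope.

(* Multi-indices of degree at most d, and of degree exactly d. *)
Notation monom_le m d := ('X_{1..m < d.+1}).
Notation monom_eq n d := ({a : 'X_{1..n < d.+1} | mdeg (bmnm a) == d}).

Definition expo n d (a : monom_eq n d) : 'X_{1..n} := bmnm (val a).

(* Vectors labelled by these index sets. *)
Notation tmvec R m d := ({ffun monom_le m d -> R}).
Notation hmvec R n d := ({ffun monom_eq n d -> R}).

Section Pairing.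
Context {R : realType}.

(* The action of a labelled vector on polynomials; it is meaningful on
   polynomials of degree at most d, resp. on forms of degree d. *)
Definition pairing m d (p : {mpoly R[m]}) (y : tmvec R m d) : R :=
  \sum_(a : monom_le m d) p@_a * y a.

Definition hpairing n d (p : {mpoly R[n]}) (y : hmvec R n d) : R :=
  \sum_(a : monom_eq n d) p@_(expo a) * y a.

End Pairing.

Section Cones.
Context {R : realType} (n d : nat).

Definition hom_power (u : 'rV[R]_n) : hmvec R n d :=
  [ffun a => \prod_(i < n) u 0 i ^+ expo a i].

Definition CP_vec : set (hmvec R n d) :=
  [set y | exists r (u : 'I_r -> 'rV[R]_n),
     (forall i j, 0 <= u i 0 j) /\ y = \sum_(i < r) hom_power (u i)].

Definition symmetric_tensor : {pred {ffun d.-tuple 'I_n -> R}} :=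
  fun A => [forall s : 'S_d, forall t : d.-tuple 'I_n,
              A [tuple tnth t (s j) | j < d] == A t].

Fact symmetric_tensor_zmod : zmod_closed symmetric_tensor.
Proof.
split=> [|A B /forallP hA /forallP hB].
  by apply/forallP => s; apply/forallP => t; rewrite !ffunE.
apply/forallP => s; apply/forallP => t; rewrite !ffunE.
by rewrite (eqP (forallP (hA s) t)) (eqP (forallP (hB s) t)).
Qed.

HB.instance Definition _ :=
  GRing.isZmodClosed.Build {ffun d.-tuple 'I_n -> R} symmetric_tensor
    symmetric_tensor_zmod.

Record sym_tensor := SymTensor {
  tensor_val :> {ffun d.-tuple 'I_n -> R};
  _ : tensor_val \in symmetric_tensor }.

HB.instance Definition _ := [isSub for tensor_val].
HB.instance Definition _ := [Choice of sym_tensor by <:].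
HB.instance Definition _ := [SubChoice_isSubZmodule of sym_tensor by <:].

Definition tensor_power_fun (v : 'rV[R]_n) : {ffun d.-tuple 'I_n -> R} :=
  [ffun t => \prod_(j < d) v 0 (tnth t j)].

Fact tensor_power_sym v : tensor_power_fun v \in symmetric_tensor.
Proof.
apply/forallP => s; apply/forallP => t; rewrite !ffunE.
rewrite [X in _ == X](reindex_inj (@perm_inj _ s)) /=.
by apply/eqP; apply: eq_bigr => j _; rewrite tnth_mktuple.
Qed.

Definition tensor_power (v : 'rV[R]_n) : sym_tensor :=
  SymTensor (tensor_power_sym v).

Definition CP_tensor : set sym_tensor :=
  [set A | exists r (v : 'I_r -> 'rV[R]_n),
     (forall i j, 0 <= v i 0 j) /\ A = \sum_(i < r) tensor_power (v i)].

(* The exponent of x_{i_1} ... x_{i_d}, for t = (i_1, ..., i_d). *)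
Definition tuple_monom (t : d.-tuple 'I_n) : 'X_{1..n} :=
  [multinom count_mem i t | i < n].

(* The default value 0 is never used; phiE below shows that the choice of t
   is irrelevant. *)
Definition phi (A : sym_tensor) : hmvec R n d :=
  [ffun a =>
     if [pick t | tuple_monom t == expo a] is Some t
     then tensor_val A t else 0].

Lemma tuple_monomX (t : d.-tuple 'I_n) :
  'X_[tuple_monom t] = \prod_(j < d) 'X_(tnth t j) :> {mpoly R[n]}.
Proof.
rewrite -(big_morph _ (@mpolyXD n R) (mpolyX0 _ _)); congr ('X_[_]); apply/mnmP => i.
rewrite mnmE mnm_sumE -sum1_count big_tuple big_mkcond /=.
by apply: eq_bigr => j _; rewrite mnm1E; case: eqP.
Qed.

Lemma phiE (A : sym_tensor) (a : monom_eq n d) (t : d.-tuple 'I_n) :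
  tuple_monom t = expo a -> phi A a = tensor_val A t.
Proof.
move=> ta; rewrite ffunE; case: pickP => [t' /eqP t'a | /(_ t)]; last first.
  by rewrite ta eqxx.
have /tuple_permP[s /val_inj ->] : perm_eq t' t.
  apply/allP => i _ /=; move/mnmP/(_ i): (etrans t'a (esym ta)).
  by rewrite !mnmE => ->.
by case: A => A /= /forallP/(_ s)/forallP/(_ t)/eqP.
Qed.

End Cones.

Arguments sym_tensor R n d : clear implicits.
Arguments CP_vec R n d : clear implicits.
Arguments CP_tensor R n d : clear implicits.

Section Dehomogenization.
Context {R : realType} (n d : nat).

Definition embed (i : 'I_n.-1) : 'I_n := widen_ord (leq_pred n) i.

(* xbar^a as a polynomial in x, and e^T x. *)
Definition xbar_monom (a : 'X_{1..n.-1}) : {mpoly R[n]} :=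
  \prod_(i < n.-1) 'X_(embed i) ^+ a i.

Definition sum_vars m : {mpoly R[m]} := \sum_(i < m) 'X_i.

(* The map varpi, f |-> f(xbar, 1 - e^T xbar). *)
Definition varpi (f : {mpoly R[n]}) : {mpoly R[n.-1]} :=
  f \mPo [tuple if insub (i : nat) is Some j then 'X_j
                else 1 - sum_vars n.-1 | i < n].

(* The map varpi^{-T}. *)
Definition varpi_invT (y : hmvec R n d) : tmvec R n.-1 d :=
  [ffun a : monom_le n.-1 d =>
     hpairing (xbar_monom a * sum_vars n ^+ (d - mdeg a)) y].

(* The inverse of varpi, from polynomials of degree at most d to forms of
   degree d: varpi_invK and varpi_invTE below justify the formula for
   varpi_invT. *)
Definition varpi_inv (p : {mpoly R[n.-1]}) : {mpoly R[n]} :=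
  \sum_(a : monom_le n.-1 d)
     p@_a *: (xbar_monom a * sum_vars n ^+ (d - mdeg a)).

Lemma varpi_embed (i : 'I_n.-1) : varpi 'X_(embed i) = 'X_i.
Proof.
rewrite /varpi comp_mpolyXU -tnth_nth tnth_mktuple.
case: insubP => [j _ ji|]; last by rewrite /= ltn_ord.
by congr 'X_(_); apply: val_inj.
Qed.

Lemma varpi_sum_vars : (0 < n)%N -> varpi (sum_vars n) = 1.
Proof.
move=> n0; have ltn : (n.-1 < n)%N by rewrite ltn_predL.
have -> : sum_vars n = \sum_(i < n.-1) 'X_(embed i) + 'X_(Ordinal ltn).
  rewrite /sum_vars; move: ltn; rewrite /embed.
  case: n n0 => // n' _ /= ltn; rewrite big_ord_recr /=.
  congr (_ + 'X_(_)); exact: val_inj.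
rewrite /varpi raddfD raddf_sum /=.
under eq_bigr => i _ do rewrite -/(varpi _) varpi_embed.
rewrite comp_mpolyXU -tnth_nth tnth_mktuple insubF /= ?ltnn //.
by rewrite -/(sum_vars _) addrC subrK.
Qed.

Lemma varpi_invK (p : {mpoly R[n.-1]}) : (0 < n)%N -> (msize p <= d.+1)%N ->
  varpi (varpi_inv p) = p.
Proof.
move=> n0 ltpd; rewrite [RHS](mpolywE ltpd) /varpi /varpi_inv raddf_sum /=.
apply: eq_bigr => a _; rewrite comp_mpolyZ rmorphM rmorphXn /=.
rewrite -/(varpi (sum_vars n)) varpi_sum_vars // expr1n mulr1 [in RHS]mpolyXE_id.
congr (_ *: _); rewrite /xbar_monom rmorph_prod /=; apply: eq_bigr => i _.
by rewrite rmorphXn /= -/(varpi _) varpi_embed.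
Qed.

Lemma varpi_invTE (p : {mpoly R[n.-1]}) (y : hmvec R n d) :
  pairing p (varpi_invT y) = hpairing (varpi_inv p) y.
Proof.
rewrite /pairing /hpairing /varpi_inv.
under eq_bigr => a _ do rewrite ffunE mulr_sumr.
rewrite exchange_big /=; apply: eq_bigr => b _; rewrite raddf_sum /= mulr_suml.
by apply: eq_bigr => a _; rewrite mcoeffZ mulrA.
Qed.

End Dehomogenization.

Section Moments.
Context {R : realType} (m k : nat).

Definition psdmx N (M : 'M[R]_N) : Prop :=
  M^T = M /\ forall v : 'cV[R]_N, 0 <= (v^T *m M *m v) 0 0.

(* k - ceil (deg q / 2) *)
Definition loc_order (q : {mpoly R[m]}) : nat := k - uphalf (msize q).-1.

(* Matrices and vectors indexed by the monomials of degree at most l are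
   ordinary ones, along the library's enumeration of these monomials. *)
Definition monom_at l (i : 'I_#|{: monom_le m l}|) : 'X_{1..m} :=
  bmnm (enum_val i).

Definition loc_mx (q : {mpoly R[m]}) (z : tmvec R m (2 * k)%N) :
    'M[R]_#|{: monom_le m (loc_order q)}| :=
  \matrix_(i, j) pairing (q * 'X_[(monom_at i + monom_at j)%MM]) z.

Definition vec_coef l (a : {mpoly R[m]}) : 'cV[R]_#|{: monom_le m l}| :=
  \col_i a@_(monom_at i).

Lemma loc_mxP (q a : {mpoly R[m]}) (z : tmvec R m (2 * k)%N) :
  (msize a <= (loc_order q).+1)%N ->
  pairing (q * a ^+ 2) z =
  ((vec_coef (loc_order q) a)^T *m loc_mx q z *m vec_coef (loc_order q) a) 0 0.
Proof.
move=> lta; pose l := loc_order q; rewrite -mulmxA mxE.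
have enumE (F : monom_le m l -> R) :
    \sum_(b : monom_le m l) F b = \sum_(i < #|{: monom_le m l}|) F (enum_val i).
  by rewrite (reindex_onto (@enum_val _ _) enum_rank) /=;
     [apply: eq_bigl => i; rewrite enum_valK eqxx | move=> i _; rewrite enum_rankK].
have pairS I (r : seq I) (F : I -> {mpoly R[m]}) :
    pairing (\sum_(i <- r) F i) z = \sum_(i <- r) pairing (F i) z.
  rewrite /pairing exchange_big /=; apply: eq_bigr => b _.
  by rewrite raddf_sum mulr_suml.
have pairZ c p : pairing (c *: p) z = c * pairing p z.
  by rewrite /pairing mulr_sumr; apply: eq_bigr => b _; rewrite mcoeffZ mulrA.
rewrite expr2 [X in q * (X * _)](mpolywE lta) [X in q * (_ * X)](mpolywE lta).
rewrite mulr_suml mulr_sumr pairS enumE.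
apply: eq_bigr => i _; rewrite !mxE !mulr_sumr pairS enumE.
apply: eq_bigr => j _; rewrite !mxE -scalerAl -scalerAr -!scalerAr !pairZ.
by rewrite -mpolyXD [X in _ = _ * X]mulrC.
Qed.

Lemma loc_mx_sym (q : {mpoly R[m]}) (z : tmvec R m (2 * k)%N) :
  (loc_mx q z)^T = loc_mx q z.
Proof. by apply/matrixP => i j; rewrite !mxE addmC. Qed.

End Moments.

Section Relaxations.
Context {R : realType} (n d : nat).

Definition sqnorm_vars m : {mpoly R[m]} := \sum_(i < m) 'X_i ^+ 2.

Definition S_simplex (k : nat) : set (tmvec R n.-1 (2 * k)%N) :=
  [set z | [/\ psdmx (loc_mx 1 z),
               forall i : 'I_n.-1, psdmx (loc_mx 'X_i z),
               psdmx (loc_mx (1 - sum_vars n.-1) z) &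
               psdmx (loc_mx (1 - sqnorm_vars n.-1) z)]].

Arguments S_simplex : clear implicits.

(* For ceil (d / 2) <= k, every index a has a (unique) counterpart b. *)
Definition F_simplex (k : nat) : set (tmvec R n.-1 d) :=
  [set y | exists2 z, S_simplex k z &
     forall (a : monom_le n.-1 d) (b : monom_le n.-1 (2 * k)%N),
       bmnm a = bmnm b -> y a = z b].

Arguments F_simplex : clear implicits.

Definition H_simplex (k : nat) : set (hmvec R n d) :=
  [set y | F_simplex k (varpi_invT y)].

End Relaxations.

Arguments H_simplex R n d k : clear implicits.

(* Main.v *)
Require Import Defs.
From HB Require Import structures.
From mathcomp Require Import all_boot all_order all_algebra.
From mathcomp Require Import boolp classical_sets reals.
From mathcomp Require Import zify ring lra.
From mathcomp Require Import mpoly.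
From mathcomp Require Import topology normedtype.

(** A point [y] of all the relaxations comes with pseudo-moment vectors of
    every order.  The ball constraint bounds each of their entries, so they
    converge along an ultrafilter to a linear functional [L] on polynomials in
    [xbar] with [L (q h^2) >= 0] for [q = 1], [x_i] and [1 - e.xbar]
    (simplex_functional).

    The constraints may be multiplied: if [0 <= a <= 1] in the sense of [L]
    then [a] is a sum of squares plus a remainder that [L] sees as small, by
    iterating [a -> a - a^2]; hence [L] is nonnegative on [a q h^2] as soon as
    it is on all [q h^2] (loc_nnegM).  This is the classical proof that a
    product of commuting positive operators is positive, and it yields
    [L >= 0] on every product of the barycentric coordinates
    [x_1, .., x_{n-1}, 1 - e.xbar].

    In homogeneous coordinates, [Lam f = L (f (xbar, 1 - e.xbar))] is
    therefore nonnegative on monomials and satisfies [Lam (e.x * f) = Lam f],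
    and [y] is the vector of the values of [Lam] on the monomials of degree
    [d] (varpi_invT_form).  Such a [Lam] is the law of an exchangeable random
    sequence with values in the variables, and the theorem of de Finetti in
    the finite form of Diaconis and Freedman applies: giving each word of
    length [N] the mass [Lam] gives its monomial, and replacing the word by its
    letter frequencies, produces finite conic combinations of powers
    [[u]_d^hom] that tend to [y] (mixture_moment_error).  The cone of such
    combinations is closed (CP_vec_closed), by the theorem of Caratheodory and
    compactness, so [y] belongs to it.

    Conversely a power [[u]_d^hom] dehomogenizes to a multiple of the moment
    vector of a point of the simplex (CP_sub_relaxations).  The tensor
    statement follows because [phi] is injective, additive and maps
    [u^{(x) d}] to [[u]_d^hom] (phi_CP). *)

Set Implicit Arguments.
Unset Strict Implicit.
Unset Printing Implicit Defensive.

Import Order.TTheory GRing.Theory Num.Theory.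
Import numFieldNormedType.Exports.

Local Open Scope ring_scope.

(** * Limits along an ultrafilter *)

(** The entries of the vectors below are controlled only from some order on. *)
Definition ev_bounded {R : realType} (u : nat -> R) :=
  exists M K, forall k, (K <= k)%N -> `|u k| <= M.

Section UltraLimit.

Local Open Scope classical_set_scope.

(** Bounded sequences converge along an ultrafilter, and the limit respects
    sums, products and order.  Such a limit makes countably many bounded
    sequences converge at once, without extracting subsequences. *)
Lemma exists_ultralimit (R : realType) : exists Lim : (nat -> R) -> R,
  [/\ forall c u v, ev_bounded u -> ev_bounded v ->
        Lim (fun k => c * u k + v k) = c * Lim u + Lim v,
      forall u v, ev_bounded u -> ev_bounded v ->
        Lim (fun k => u k * v k) = Lim u * Lim v,
      forall c, Lim (fun=> c) = c &
      forall u, ev_bounded u -> (exists K, forall k, (K <= k)%N -> 0 <= u k) ->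
        0 <= Lim u].
Proof.
have [U [UU sU]] := ultraFilterLemma (F := \oo) _.
have PU : ProperFilter U by exact: ultra_proper.
have evU (P : nat -> Prop) K : (forall k, (K <= k)%N -> P k) -> U P.
  by move=> h; apply: sU; exists K.
pose Lim (u : nat -> R) : R := lim (u @ U).
have cvgU u : ev_bounded u -> u @ U --> Lim u.
  case=> M [K h].
  have FM : (u @ U) `[- M, M].
    by apply: (evU _ K) => k Kk; rewrite /= in_itv /= -ler_norml h.
  have [l [_ ul]] := @segment_compact R (- M) M (u @ U) _ FM.
  suff lim_l : u @ U --> l by exact: cvgP lim_l.
  move=> B lB.
  (* the ultrafilter contains the preimage of [B] or its complement, and the
     latter is incompatible with [l] being a cluster point *)
  have [//|UnB] := in_ultra_setVsetC (u @^-1` B) UU.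
  by have [x [+ Bx]] := ul (~` B) B UnB lB.
have LimE u l : u @ U --> l -> Lim u = l by move=> /cvg_lim; apply.
exists Lim; split=> [c u v bu bv|u v bu bv|c|u bu [K h]].
- by apply: LimE; apply: cvgD (cvgU _ bv); apply: cvgZr; exact: cvgU.
- by apply: LimE; apply: cvgM; exact: cvgU.
- by apply: LimE; apply: cvg_cst.
- apply: limr_ge; first exact: cvgP (cvgU _ bu).
  exact: (evU _ K).
Qed.

Context {R : realType}.
Implicit Types (u v : nat -> R).

Definition ulim : (nat -> R) -> R := sval (cid (exists_ultralimit R)).

Lemma ulim_lin c u v : ev_bounded u -> ev_bounded v ->
  ulim (fun k => c * u k + v k) = c * ulim u + ulim v.
Proof. by rewrite /ulim; case: cid => /= ? [+ _ _ _]; apply. Qed.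

Lemma ulimM u v : ev_bounded u -> ev_bounded v ->
  ulim (fun k => u k * v k) = ulim u * ulim v.
Proof. by rewrite /ulim; case: cid => /= ? [_ + _ _]; apply. Qed.

Lemma ulim_cst c : ulim (fun=> c) = c.
Proof. by rewrite /ulim; case: cid => /= ? [_ _ + _]; apply. Qed.

Lemma ulim_ge0 u : ev_bounded u ->
  (exists K, forall k, (K <= k)%N -> 0 <= u k) -> 0 <= ulim u.
Proof. by rewrite /ulim; case: cid => /= ? [_ _ _ +]; apply. Qed.

Lemma ev_bounded_cst c : ev_bounded (fun=> c : R).
Proof. by exists `|c|, 0%N. Qed.

Lemma ev_boundedD u v : ev_bounded u -> ev_bounded v ->
  ev_bounded (fun k => u k + v k).
Proof.
move=> [M [K hM]] [M' [K' hM']]; exists (M + M'), (maxn K K') => k.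
rewrite geq_max => /andP[Kk K'k]; apply: le_trans (ler_normD _ _) _.
by rewrite lerD ?hM ?hM'.
Qed.

Lemma ev_boundedM u v : ev_bounded u -> ev_bounded v ->
  ev_bounded (fun k => u k * v k).
Proof.
move=> [M [K hM]] [M' [K' hM']]; exists (M * M'), (maxn K K') => k.
by rewrite geq_max => /andP[Kk K'k]; rewrite normrM ler_pM ?hM ?hM'.
Qed.

Lemma ulim_sum I (r : seq I) (u : I -> nat -> R) :
  (forall i, ev_bounded (u i)) ->
  ev_bounded (fun k => \sum_(i <- r) u i k) /\
  ulim (fun k => \sum_(i <- r) u i k) = \sum_(i <- r) ulim (u i).
Proof.
move=> bu; elim: r => [|i r [b lim_r]].
  under eq_fun do rewrite big_nil.
  by rewrite big_nil ulim_cst; split=> //; apply: ev_bounded_cst.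
under eq_fun do rewrite big_cons -[u i _]mul1r.
rewrite big_cons ulim_lin // mul1r lim_r; split=> //.
by under eq_fun do rewrite mul1r; apply: ev_boundedD.
Qed.

Lemma ulim_prod I (r : seq I) (u : I -> nat -> R) :
  (forall i, ev_bounded (u i)) ->
  ev_bounded (fun k => \prod_(i <- r) u i k) /\
  ulim (fun k => \prod_(i <- r) u i k) = \prod_(i <- r) ulim (u i).
Proof.
move=> bu; elim: r => [|i r [b lim_r]].
  under eq_fun do rewrite big_nil.
  by rewrite big_nil ulim_cst; split=> //; apply: ev_bounded_cst.
under eq_fun do rewrite big_cons.
by rewrite big_cons ulimM // lim_r; split=> //; apply: ev_boundedM.
Qed.

Lemma ulimX u e : ev_bounded u ->
  ev_bounded (fun k => u k ^+ e) /\ ulim (fun k => u k ^+ e) = ulim u ^+ e.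
Proof.
move=> bu; have := @ulim_prod _ (index_enum 'I_e) (fun=> u) (fun=> bu).
by rewrite prodr_const card_ord; under eq_fun do rewrite prodr_const card_ord.
Qed.

Lemma ulim_cvg u l :
  (forall e, 0 < e -> exists K, forall k, (K <= k)%N -> `|u k - l| <= e) ->
  ev_bounded u /\ ulim u = l.
Proof.
move=> ul; have bu : ev_bounded u.
  have [K h] := ul _ ltr01; exists (`|l| + 1), K => k /h le1.
  by rewrite -[u k](subrK l) addrC (le_trans (ler_normD _ _)) ?lerD2l.
split=> //; apply/eqP; rewrite -subr_eq0 -normr_le0.
apply/ler_addgt0Pl => e e0; rewrite addr0 ler_norml.
have [K h] := ul _ e0.
have lo : 0 <= ulim (fun k => 1 * u k + (e - l)).
  apply: ulim_ge0.
    apply: ev_boundedD; [apply: ev_boundedM => // |]; exact: ev_bounded_cst.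
  by exists K => k /h; rewrite ler_norml => /andP[+ _]; lra.
have hi : 0 <= ulim (fun k => -1 * u k + (e + l)).
  apply: ulim_ge0.
    apply: ev_boundedD; [apply: ev_boundedM => // |]; exact: ev_bounded_cst.
  by exists K => k /h; rewrite ler_norml => /andP[_ +]; lra.
move: lo hi; rewrite !ulim_lin ?ulim_cst //; do ?exact: ev_bounded_cst.
by move=> lo hi; apply/andP; split; lra.
Qed.

End UltraLimit.

(** * Products of nonnegative elements *)

Section PositiveFunctional.
Context {R : realType} {A : comAlgType R} (L : {scalar A}).

(** [a] is nonnegative in the eyes of [L]; for functionals given by moments
    this is the positivity of all localizing matrices of [a]. *)
Definition loc_nneg (a : A) := forall h, 0 <= L (a * h ^+ 2).

Lemma loc_nnegD a b : loc_nneg a -> loc_nneg b -> loc_nneg (a + b).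
Proof. by move=> pa pb h; rewrite mulrDl linearD addr_ge0. Qed.

Lemma loc_nnegM_sqr a h : loc_nneg a -> loc_nneg (a * h ^+ 2).
Proof. by move=> pa g; rewrite -mulrA -exprMn. Qed.

(** The map [x -> x - x^2] preserves the interval [0, 1] and its iterates tend
    to 0, while [a] minus its [N]-th iterate is a sum of squares. *)
Definition logistic (a : A) := a - a ^+ 2.

Lemma logistic_nneg a : loc_nneg a -> loc_nneg (1 - a) ->
  loc_nneg (logistic a) /\ loc_nneg (1 - logistic a).
Proof.
move=> pa p1a; split.
  have -> : logistic a = a * (1 - a) ^+ 2 + (1 - a) * a ^+ 2.
    by rewrite /logistic; ring.
  by apply: loc_nnegD; apply: loc_nnegM_sqr.
have -> : 1 - logistic a = (1 - a) + (1 - a) * a ^+ 2 + a * a ^+ 2.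
  by rewrite /logistic; ring.
by do 2?apply: loc_nnegD => //; apply: loc_nnegM_sqr.
Qed.

Lemma iter_logistic_nneg a N : loc_nneg a -> loc_nneg (1 - a) ->
  loc_nneg (iter N logistic a) /\ loc_nneg (1 - iter N logistic a).
Proof. by move=> pa p1a; elim: N => //= N [p q]; apply: logistic_nneg. Qed.

Lemma logistic_expansion a N :
  a = \sum_(i < N) iter i logistic a ^+ 2 + iter N logistic a.
Proof.
elim: N => [|N IH]; first by rewrite big_ord0 add0r.
by rewrite big_ord_recr /= {1}IH /logistic -!addrA [_ ^+ 2 + _]addrC subrK.
Qed.

(** The squares of all iterates have total at most [a], so they cannot all
    stay above [e] in the eyes of [L]. *)
Lemma iter_logistic_small a h e : loc_nneg a -> loc_nneg (1 - a) -> 0 < e ->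
  exists N, L (iter N logistic a ^+ 2 * h ^+ 2) <= e.
Proof.
move=> pa p1a e0; apply: contrapT => /forallNP H.
have big N : N%:R * e <= L (a * h ^+ 2).
  rewrite [X in L (X * _)](logistic_expansion a N) mulrDl linearD.
  have /(_ h) := (iter_logistic_nneg N pa p1a).1.
  suff : N%:R * e <= L ((\sum_(i < N) iter i logistic a ^+ 2) * h ^+ 2) by lra.
  rewrite mulr_suml linear_sum -[X in X%:R * _]card_ord mulr_natl -sumr_const.
  by apply: ler_sum => i _; rewrite ltW // ltNge; apply/negP/H.
have := big (Num.bound (L (a * h ^+ 2) / e)).
rewrite leNgt -ltr_pdivrMr // => /negP; apply.
exact/archi_boundP/divr_ge0/ltW.
Qed.

(** Up to a remainder [aN], the factor [a] is a sum of squares, which may be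
    moved into [h^2].  The remainder contributes little: by Cauchy-Schwarz
    [L (aN q g^2)] is bounded through [L (aN^2 g^2)], which is small. *)
Lemma loc_nnegM a q :
  loc_nneg 1 -> loc_nneg a -> loc_nneg (1 - a) -> loc_nneg q ->
  loc_nneg (a * q).
Proof.
move=> p1 pa p1a pq g; set C := L (q ^+ 2 * g ^+ 2).
have C0 : 0 <= C by rewrite /C -exprMn -[_ ^+ 2]mul1r.
suff key d : 0 < d -> - (d * (1 + C)) <= 2 * L (a * q * g ^+ 2).
  rewrite leNgt; apply/negP => lt0; set v := L _ in key lt0.
  have d0 : 0 < - v / (1 + C) by apply: divr_gt0; lra.
  by have := key _ d0; rewrite divfK; lra.
move=> d0; have [N] := iter_logistic_small g pa p1a (exprn_gt0 2 d0).
set aN := iter N logistic a => small.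
(* Cauchy-Schwarz, in the form of one square with a free parameter [d] *)
have cs : 0 <= L (1 * ((aN + d *: q) * g) ^+ 2) by exact: p1.
have E : L (1 * ((aN + d *: q) * g) ^+ 2) =
    L (aN ^+ 2 * g ^+ 2) + d * (2 * L (aN * q * g ^+ 2)) + d ^+ 2 * C.
  have -> : 1 * ((aN + d *: q) * g) ^+ 2 = aN ^+ 2 * g ^+ 2 +
      d *: (2%:R *: (aN * q * g ^+ 2)) + d ^+ 2 *: (q ^+ 2 * g ^+ 2).
    have [D dE] : exists D : A, forall x, d *: x = D * x.
      by exists d%:A => x; rewrite mulr_algl.
    rewrite [d ^+ 2]expr2 -scalerA !dE scaler_nat; ring.
  by rewrite !linearD !linearZ.
have le : L (aN * q * g ^+ 2) <= L (a * q * g ^+ 2).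
  have -> : a * q * g ^+ 2 =
      \sum_(i < N) q * iter i logistic a ^+ 2 * g ^+ 2 + aN * q * g ^+ 2.
    by rewrite {1}(logistic_expansion a N) -mulrA mulrDl mulr_suml mulrA;
       congr (_ + _); apply: eq_bigr => i _; ring.
  by rewrite linearD linear_sum lerDr sumr_ge0 // => i _; apply: loc_nnegM_sqr.
move: cs; rewrite E => cs.
have : 0 <= d * (d * (1 + C) + 2 * L (aN * q * g ^+ 2)) by lra.
by rewrite pmulr_rge0 //; lra.
Qed.

End PositiveFunctional.

(** * Closedness of the cone *)

Lemma exists_nth_root (F : rcfType) d (c : F) : (0 < d)%N -> 0 <= c ->
  exists2 x, 0 <= x & x ^+ d = c.
Proof.
move=> d0 c0; have [||x] := @poly_ivt F ('X^d - c%:P) 0 (c + 1).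
- by rewrite addr_ge0.
- rewrite !hornerE expr0n (gtn_eqF d0) sub0r oppr_le0 c0 /= subr_ge0.
  by rewrite (@le_trans _ _ (c + 1)) ?lerDl // ler_eXnr // lerDr.
- by move=> /andP[x0 _] /rootP; rewrite !hornerE => /subr0_eq; exists x.
Qed.

(** More weights than coordinates admit a linear relation [e] between the
    points; moving along [- e] until a first weight vanishes keeps the sum. *)
Lemma drop_dependent_weight (F : realFieldType) r D (G : 'M[F]_(r, D))
    (c : 'rV[F]_r) : (D < r)%N -> (forall i, 0 <= c 0 i) ->
  exists c' : 'rV_r, [/\ forall i, 0 <= c' 0 i, c' *m G = c *m G &
    exists i0, c' 0 i0 = 0].
Proof.
move=> Dr c0.
have : kermx G != 0.
  by rewrite kermx_eq0 -row_leq_rank -ltnNge (leq_ltn_trans _ Dr) ?rank_leq_col.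
case/rowV0Pn => e /sub_kermxP eG e_neq0.
wlog [i1 ei1] : e eG e_neq0 / exists i1, 0 < e 0 i1.
  move=> wl; have [i ei] := rV0Pn _ e_neq0.
  case: (ltrP 0 (e 0 i)) => [pos|neg]; first by apply: (wl e) => //; exists i.
  apply: (wl (- e)); rewrite ?oppr_eq0 ?mulNmx ?eG ?oppr0 //.
  by exists i; rewrite mxE oppr_gt0 lt_neqAle ei.
pose i0 := [arg min_(i < i1 | 0 < e 0 i) c 0 i / e 0 i]%O.
have [ei0 min_i0] : 0 < e 0 i0 /\
    forall j, 0 < e 0 j -> c 0 i0 / e 0 i0 <= c 0 j / e 0 j.
  by rewrite /i0; case: arg_minP.
set t := c 0 i0 / e 0 i0 in min_i0.
have t0 : 0 <= t by rewrite divr_ge0 // ltW.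
exists (c - t *: e); split=> [i||].
- rewrite !mxE subr_ge0; have [ei|ei] := ltrP 0 (e 0 i).
    by rewrite -ler_pdivlMr // min_i0.
  by rewrite (le_trans _ (c0 i)) // mulr_ge0_le0.
- by rewrite mulmxBl -scalemxAl eG scaler0 subr0.
- by exists i0; rewrite !mxE divfK ?subrr // gt_eqF.
Qed.

(** Points and weights are indexed by [nat] so that sums with fewer than [#|I|]
    terms can be padded by zero weights. *)
Lemma caratheodory (F : realFieldType) (I : finType) (X : Type) (g : X -> I -> F)
    (K : X -> Prop) r (p : nat -> X) (c : nat -> F) :
  (forall i, K (p i)) -> (forall i, 0 <= c i) ->
  exists (p' : nat -> X) (c' : nat -> F),
    [/\ forall i, K (p' i), forall i, 0 <= c' i &
        forall a, \sum_(i < #|I|) c' i * g (p' i) a =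
                  \sum_(i < r) c i * g (p i) a].
Proof.
elim: r p c => [|r IH] p c Kp c0.
  exists p, (fun=> 0); split=> // a.
  by rewrite big_ord0 big1 // => i _; rewrite mul0r.
have [rI|Ir] := ltnP r #|I|.
  exists p, (fun i => if (i < r.+1)%N then c i else 0); split=> // [i|a].
    by case: ifP.
  rewrite (big_ord_widen _ (fun i => c i * g (p i) a) rI) [RHS]big_mkcond /=.
  by apply: eq_bigr => i _; case: ifP; rewrite ?mul0r.
pose G := \matrix_(i < r.+1, j < #|I|) g (p i) (enum_val j).
have [| |c' [c'0 c'G [i0 c'i0]]] := @drop_dependent_weight _ _ _ G (\row_i c i).
- by rewrite ltnS.
- by move=> i; rewrite mxE.
have [i|i|p2 [c2 [Kp2 c20 E]]] := IH (fun i => p (bump i0 i))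
  (fun i => c' 0 (inord (bump i0 i))); [exact: Kp | exact: c'0 |].
exists p2, c2; split=> // a; rewrite {}E.
have /rowP/(_ (enum_rank a)) := c'G; rewrite !mxE.
rewrite [X in _ = X -> _](eq_bigr (fun i : 'I_r.+1 => c i * g (p i) a));
  last by move=> i _; rewrite !mxE enum_rankK.
move<-; rewrite (bigD1_ord i0) //= c'i0 mul0r add0r.
apply: eq_bigr => i _.
by rewrite mxE enum_rankK -[bump i0 i]/(val (lift i0 i)) inord_val.
Qed.

Section ConeOfMoments.
Context {R : realType} {n d : nat}.

Lemma hom_powerZ x (u : 'rV[R]_n) (b : monom_eq n d) :
  hom_power d (x *: u) b = x ^+ d * hom_power d u b.
Proof.
rewrite !ffunE; under eq_bigr do rewrite mxE exprMn.
rewrite big_split /= prodrXr; congr (x ^+ _ * _).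
by rewrite -mdegE; apply/eqP; exact: (valP b).
Qed.

(** Nonnegative weights are absorbed into the points by a [d]-th root. *)
Lemma CP_vec_conic r (c : nat -> R) (p : nat -> 'rV[R]_n) (y : hmvec R n d) :
  (0 < d)%N -> (forall i, 0 <= c i) -> (forall i j, 0 <= p i 0 j) ->
  (forall b, y b = \sum_(i < r) c i * hom_power d (p i) b) -> CP_vec R n d y.
Proof.
move=> d0 c0 p0 yE.
have /choice[x xP] i : exists x, 0 <= x /\ x ^+ d = c i.
  by have [x] := exists_nth_root d0 (c0 i); exists x.
exists r, (fun i => x i *: p i); split=> [i j|].
  by rewrite mxE mulr_ge0 ?(xP i).1.
apply/ffunP => b; rewrite yE sum_ffunE; apply: eq_bigr => i _.
by rewrite hom_powerZ (xP i).2.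
Qed.

(** Caratheodory bounds the number of terms uniformly in [N]; the bound [C] on
    the mass and the box then keep weights and points bounded, and their
    limits represent [y]. *)
Lemma CP_vec_closed (T : nat -> finType) (c : forall N, T N -> R)
    (p : forall N, T N -> 'rV[R]_n) (y : hmvec R n d) (C : R) :
  (0 < d)%N -> (forall N t, 0 <= c N t) ->
  (forall N t j, 0 <= p N t 0 j <= 1) ->
  (forall N, \sum_t c N t <= C) ->
  (forall b (e : R), 0 < e -> exists K, forall N, (K <= N)%N ->
     `|\sum_t c N t * hom_power d (p N t) b - y b| <= e) ->
  CP_vec R n d y.
Proof.
move=> d0 c0 pbox cC cvg_y.
pose box (x : 'rV[R]_n) := forall j, 0 <= x 0 j <= 1.
(* the extra coordinate preserves the total mass, hence bounds the weights *)
pose g (x : 'rV[R]_n) (a : option (monom_eq n d)) :=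
  if a is Some b then hom_power d x b else 1.
set D := #|{: option (monom_eq n d)}|.
have /choice[qw qwP] N : exists qw : (nat -> 'rV[R]_n) * (nat -> R),
    [/\ forall i, box (qw.1 i), forall i, 0 <= qw.2 i &
        forall a, \sum_(i < D) qw.2 i * g (qw.1 i) a =
                  \sum_t c N t * g (p N t) a].
  have [||q [w [qb w0 qwE]]] := @caratheodory R _ _ g box #|T N|
      (fun i => nth 0 [seq p N t | t <- enum (T N)] i)
      (fun i => nth 0 [seq c N t | t <- enum (T N)] i).
  - move=> i; have [lt|ge] := ltnP i (size [seq p N t | t <- enum (T N)]).
      by have /mapP[t _ ->] := mem_nth 0 lt; exact: pbox.
    by rewrite nth_default // => j; rewrite mxE lexx ler01.
  - move=> i; have [lt|ge] := ltnP i (size [seq c N t | t <- enum (T N)]).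
      by have /mapP[t _ ->] := mem_nth 0 lt; exact: c0.
    by rewrite nth_default.
  exists (q, w); split=> // a; rewrite qwE.
  have -> : \sum_t c N t * g (p N t) a =
            \sum_(t in T N) c N t * g (p N t) a by [].
  rewrite [RHS]big_enum_val.
  have nth_enum (V : Type) (v0 : V) (f : T N -> V) (i : 'I_#|T N|) :
      nth v0 [seq f t | t <- enum (T N)] i = f (enum_val i).
    by rewrite (nth_map (enum_default i)) // -cardE.
  by apply: eq_bigr => i _; rewrite !nth_enum.
pose q N := (qw N).1; pose w N := (qw N).2.
have wC i N : (i < D)%N -> 0 <= w N i <= C.
  move=> iD; have [_ w0 /(_ None)] := qwP N; rewrite w0 /=.
  under eq_bigr do rewrite mulr1; under [RHS]eq_bigr do rewrite mulr1.
  move=> wE; rewrite (le_trans _ (cC N)) // -wE (bigD1 (Ordinal iD)) //= lerDl.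
  exact: sumr_ge0.
have qb i j : ev_bounded (fun N => q N i 0 j).
  exists 1, 0%N => N _; have [/(_ i j)/andP[q0 q1] _ _] := qwP N.
  by rewrite ger0_norm.
have wb i : (i < D)%N -> ev_bounded (fun N => w N i).
  move=> iD; exists C, 0%N => N _; have /andP[w0 ?] := wC i N iD.
  by rewrite ger0_norm.
pose wl i := if (i < D)%N then ulim (fun N => w N i) else 0.
apply: (@CP_vec_conic D wl (fun i => \row_j ulim (fun N => q N i 0 j))) => //.
- move=> i; rewrite /wl; case: ifP => // iD; apply: ulim_ge0; first exact: wb.
  by exists 0%N => N _; have /andP[] := wC i N iD.
- move=> i j; rewrite mxE; apply: ulim_ge0; first exact: qb.
  by exists 0%N => N _; have [/(_ i j)/andP[]] := qwP N.
move=> b; have [_ <-] := ulim_cvg (cvg_y b).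
have -> : (fun N => \sum_t c N t * hom_power d (p N t) b) =
    fun N => \sum_(i < D) w N i * \prod_(j < n) q N i 0 j ^+ expo b j.
  apply/funext => N; have [_ _ /(_ (Some b)) /= <-] := qwP N.
  by apply: eq_bigr => i _; rewrite ffunE.
have prod_b i := ulim_prod (index_enum 'I_n)
  (fun j => (ulimX (expo b j) (qb i j)).1).
rewrite (ulim_sum _ _).2 => [|i]; last first.
  exact: ev_boundedM (wb _ (ltn_ord i)) (prod_b i).1.
apply: eq_bigr => i _; rewrite ulimM; [|exact: wb|exact: (prod_b i).1].
rewrite (prod_b i).2 /wl ltn_ord ffunE; congr (_ * _).
by apply: eq_bigr => j _; rewrite mxE (ulimX _ (qb i j)).2.
Qed.

End ConeOfMoments.

(** * The finite de Finetti theorem *)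

(** The left side is the probability of a collision among [D] uniform draws
    from [N] values, and each pair of draws collides with probability [1 / N]. *)
Lemma ffact_ratio (F : realFieldType) N D : (0 < N)%N ->
  1 - (N ^_ D)%:R / N%:R ^+ D <= (D ^ 2)%:R / N%:R :> F.
Proof.
move=> N0; have N0' : 0 < N%:R :> F by rewrite ltr0n.
elim: D => [|D IH]; first by rewrite ffactn0 expr0 divr1 subrr mul0r.
have r0 : 0 <= (N ^_ D)%:R / N%:R ^+ D :> F.
  by rewrite divr_ge0 // exprn_ge0 // ltW.
have r1 : (N ^_ D)%:R / N%:R ^+ D <= 1 :> F.
  rewrite ler_pdivrMr ?exprn_gt0 // mul1r -natrX ler_nat.
  have := card_inj_ffuns 'I_D 'I_N; rewrite !card_ord => <-.
  by rewrite (leq_trans (max_card _)) // card_ffun !card_ord.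
move: r0 r1 IH; set r := _ / _ => r0 r1 IH.
have rS : r * (1 - D%:R / N%:R) <= (N ^_ D.+1)%:R / N%:R ^+ D.+1.
  have -> : (N ^_ D.+1)%:R / N%:R ^+ D.+1 = r * ((N - D)%N%:R / N%:R) :> F.
    by rewrite ffactnSr exprSr natrM invfM mulrACA.
  have leN : N%:R <= (N - D)%N%:R + D%:R :> F by rewrite -natrD ler_nat; lia.
  rewrite ler_wpM2l // -{1}(divff (lt0r_neq0 N0')) -mulrBl ler_pM2r ?invr_gt0 //.
  by rewrite lerBlDr.
have Dr : r * (D%:R / N%:R) <= D%:R / N%:R by rewrite ler_piMl // divr_ge0.
have : (D ^ 2)%:R / N%:R + D%:R / N%:R <= (D.+1 ^ 2)%:R / N%:R :> F.
  by rewrite -mulrDl -natrD ler_pM2r ?invr_gt0 // ler_nat; lia.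
lra.
Qed.

Section DeFinetti.
Context {R : realType} {n : nat} (Lam : {scalar {mpoly R[n]}}).
Context (Lam_ge0 : forall a : 'X_{1..n}, 0 <= Lam 'X_[a]).
Context (Lam_sum : forall p, Lam (sum_vars n * p) = Lam p).

Definition word_monom N (T : 'I_N -> 'I_n) : {mpoly R[n]} := \prod_i 'X_(T i).

Lemma word_monom_ge0 N (T : 'I_N -> 'I_n) : 0 <= Lam (word_monom T).
Proof.
by rewrite /word_monom -(big_morph _ (@mpolyXD n R) (mpolyX0 _ _)).
Qed.

Lemma Lam_sumX N p : Lam (sum_vars n ^+ N * p) = Lam p.
Proof. by elim: N => [|N IH]; rewrite ?mul1r // exprS -mulrA Lam_sum. Qed.

Lemma sum_word_monom N :
  \sum_(T : {ffun 'I_N -> 'I_n}) word_monom T = sum_vars n ^+ N.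
Proof.
by rewrite -(bigA_distr_bigA (fun _ c => 'X_c)) prodr_const card_ord.
Qed.

Lemma sum_word_mass N : \sum_(T : {ffun 'I_N -> 'I_n}) Lam (word_monom T) = Lam 1.
Proof. by rewrite -linear_sum sum_word_monom -[_ ^+ _]mulr1 Lam_sumX. Qed.

Definition freq N (T : 'I_N -> 'I_n) : 'rV[R]_n :=
  \row_c (\sum_(i < N) (T i == c)%:R / N%:R).

Lemma freq_box N (T : 'I_N -> 'I_n) c : 0 <= freq T 0 c <= 1.
Proof.
rewrite mxE -mulr_suml; case: N T => [|N] T.
  by rewrite invr0 mulr0 lexx ler01.
rewrite divr_ge0 ?sumr_ge0 //= ler_pdivrMr ?ltr0Sn // mul1r.
rewrite -[X in _ <= X%:R]card_ord -sumr_const.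
by apply: ler_sum => i _; case: eqP.
Qed.

Section Words.
Context {J : finType} (s : J -> 'I_n) (N : nat).

(** Up to the factor [Lam 1], the probability that a random word of law [Lam]
    reads [s] at the positions [f]. *)
Definition extension_mass (f : J -> 'I_N) : R :=
  \sum_(T : {ffun 'I_N -> 'I_n})
    Lam (word_monom T) * \prod_j (T (f j) == s j)%:R.

Lemma extension_mass_bounds f : 0 <= extension_mass f <= Lam 1.
Proof.
rewrite -(sum_word_mass N); apply/andP; split.
  by apply: sumr_ge0 => T _; rewrite mulr_ge0 ?word_monom_ge0 // prodr_ge0.
apply: ler_sum => T _; rewrite ler_piMr ?word_monom_ge0 // prodr_ile1 // => j _.
by case: eqP; rewrite ?lexx ler01.
Qed.

(** Distinct positions fix the letters [s] there and leave the others free, so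
    the monomials of these words add up to the monomial of [s] times a power
    of [e.x], to which [Lam] is blind. *)
Lemma extension_mass_inj f : injective f ->
  extension_mass f = Lam (\prod_j 'X_(s j)).
Proof.
move=> f_inj; rewrite -[RHS](Lam_sumX (N - #|J|)).
pose F i c : {mpoly R[n]} := (\prod_(j | f j == i) (c == s j)%:R) *: 'X_c.
have -> : extension_mass f =
    Lam (\sum_(T : {ffun 'I_N -> 'I_n}) \prod_i F i (T i)).
  rewrite linear_sum; apply: eq_bigr => T _; rewrite scaler_prod linearZ mulrC.
  congr (_ * _); rewrite (partition_big f xpredT) //=.
  by apply: eq_bigr => i _; apply: eq_bigr => j /eqP ->.
congr (Lam _); rewrite -(bigA_distr_bigA F).
rewrite (bigID (mem [set f j | j in J])) /= mulrC big_imset /=; last exact: in2W.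
congr (_ * _); last first.
  have FE j c : F (f j) c = (c == s j)%:R *: 'X_c.
    by rewrite /F (eq_bigl (pred1 j)) ?big_pred1_eq // => j'; rewrite /= inj_eq.
  apply: eq_bigr => j _; rewrite (bigD1 (s j)) //= FE eqxx scale1r.
  by rewrite big1 ?addr0 // => c /negPf cs; rewrite FE cs scale0r.
rewrite (eq_bigr (fun=> sum_vars n)) => [|i inf]; last first.
  apply: eq_bigr => c _; rewrite /F big_pred0 ?scale1r // => j.
  by apply: contraNF inf => /eqP <-; exact: imset_f.
rewrite prodr_const; congr (_ ^+ _).
rewrite -[X in (X - _)%N](card_ord N) -(card_imset J f_inj).
by rewrite -(cardC [set f j | j in J]) addKn.
Qed.

(** A product of frequencies counts the tuples of positions, repetitions
    included, at which the word reads [s]. *)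
Lemma mixture_moment : (0 < N)%N ->
  \sum_(T : {ffun 'I_N -> 'I_n}) Lam (word_monom T) * \prod_j freq T 0 (s j) =
  (\sum_(f : {ffun J -> 'I_N}) extension_mass f) / N%:R ^+ #|J|.
Proof.
move=> N0; rewrite exchange_big /= mulr_suml; apply: eq_bigr => T _.
rewrite -mulr_sumr -mulrA; congr (_ * _).
under eq_bigr do rewrite mxE -mulr_suml.
rewrite big_split /= prodr_const exprVn; congr (_ * _).
by rewrite (bigA_distr_bigA (fun j i => (T i == s j)%:R)).
Qed.

(** Tuples of distinct positions contribute exactly the wanted value, and the
    proportion of the others tends to 0. *)
Lemma mixture_moment_error : (0 < N)%N ->
  `|\sum_(T : {ffun 'I_N -> 'I_n}) Lam (word_monom T) * \prod_j freq T 0 (s j)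
    - Lam (\prod_j 'X_(s j))| <=
  (Lam 1 + Lam (\prod_j 'X_(s j))) * ((#|J| ^ 2)%:R / N%:R).
Proof.
move=> N0; rewrite mixture_moment //; set c := Lam (\prod_j _).
have c0 : 0 <= c by rewrite /c -(big_morph _ (@mpolyXD n R) (mpolyX0 _ _)).
have Lam10 : 0 <= Lam 1 by rewrite -(mpolyX0 _ _).
have N0' : 0 < N%:R ^+ #|J| :> R by rewrite exprn_gt0 // ltr0n.
apply: le_trans (ler_wpM2l (addr_ge0 Lam10 c0) (ffact_ratio R #|J| N0)).
pose inj := [set f : {ffun J -> 'I_N} | injectiveb f].
have -> : (N ^_ #|J|)%:R = #|inj|%:R :> R by rewrite card_inj_ffuns card_ord.
have cardE : N%:R ^+ #|J| = #|inj|%:R + #|~: inj|%:R :> R.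
  by rewrite -natrD cardsC card_ffun card_ord natrX.
rewrite (bigID (mem inj)) /= (eq_bigr (fun=> c)) => [|f]; last first.
  by rewrite inE => /injectiveP; exact: extension_mass_inj.
rewrite sumr_const -[c *+ _]mulr_natl; set S := \sum_(_ | _) _.
have S0 : 0 <= S.
  by apply: sumr_ge0 => f _; have /andP[] := extension_mass_bounds f.
have SB : S <= #|~: inj|%:R * Lam 1.
  rewrite mulr_natl -sumr_const; rewrite [leRHS](eq_bigl (fun f => f \notin inj)).
    by apply: ler_sum => f _; have /andP[] := extension_mass_bounds f.
  by move=> f; rewrite finset.in_setC.
move: #|inj|%:R #|~: inj|%:R (ler0n R #|~: inj|) cardE SB => x z z0 cardE SB.
have -> : (x * c + S) / N%:R ^+ #|J| - c = (S - z * c) / N%:R ^+ #|J|.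
  by rewrite -[X in _ - X](mulfK (lt0r_neq0 N0')) -mulrBl cardE;
     congr (_ / _); ring.
have -> : 1 - x / N%:R ^+ #|J| = z / N%:R ^+ #|J|.
  by rewrite -[X in X - _](divff (lt0r_neq0 N0')) -mulrBl cardE;
     congr (_ / _); ring.
rewrite normrM normfV (gtr0_norm N0') mulrA ler_pM2r ?invr_gt0 // ler_norml.
by apply/andP; split; nra.
Qed.

End Words.

(** The letters of long words of law [Lam] are almost independent once the
    letter frequencies are known, so the moments of these frequencies, which
    are points of the simplex, tend to the values of [Lam]. *)
Theorem de_finetti_CP d : (0 < d)%N ->
  CP_vec R n d [ffun b => Lam 'X_[expo b]].
Proof.
move=> d0; have Lam10 : 0 <= Lam 1 by rewrite -(mpolyX0 _ _).
apply: (@CP_vec_closed _ _ _ (fun N => {ffun 'I_N -> 'I_n})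
  (fun N T => Lam (word_monom T)) (fun N T => freq T) _ (Lam 1)) => //.
- by move=> N T; exact: word_monom_ge0.
- by move=> N T c; exact: freq_box.
- by move=> N; rewrite sum_word_mass.
(* [b] is spelled as the word indexed by the pairs of a variable and one of
   its occurrences, so that its letters are the first components *)
move=> b e e0; pose J := {c : 'I_n & 'I_(expo b c)}.
have prodE (S : comRingType) (F : 'I_n -> S) :
    \prod_(j : J) F (tag j) = \prod_c F c ^+ expo b c.
  rewrite -(sig_big_dep xpredT (fun _ => xpredT) (fun c _ => F c)) /=.
  by apply: eq_bigr => c _; rewrite prodr_const card_ord.
pose C := (Lam 1 + Lam 'X_[expo b]) * (#|{: J}| ^ 2)%:R / e.
have C0 : 0 <= C by rewrite divr_ge0 ?mulr_ge0 ?addr_ge0 // ltW.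
exists (Num.bound C) => N leN; have N0 : (0 < N)%N.
  by apply: leq_trans leN; rewrite -(ltr0n R) (le_lt_trans C0) ?archi_boundP.
have := @mixture_moment_error J tag N N0.
rewrite (prodE _ (fun c => 'X_c : {mpoly R[n]})) -mpolyXE_id ffunE.
under eq_bigr => T _ do rewrite (prodE _ (fun c => freq T 0 c)).
under [X in _ -> `|X - _| <= _]eq_bigr => T _ do rewrite ffunE.
move/le_trans; apply; rewrite mulrA ler_pdivrMr ?ltr0n // -ler_pdivrMl // mulrC.
by apply: le_trans (ltW (archi_boundP C0)) _; rewrite ler_nat.
Qed.

End DeFinetti.

(** * Moment functionals of the relaxations *)

Lemma multinom_ind m (P : 'X_{1..m} -> Prop) :
  P 0%MM -> (forall i a, P a -> P (U_(i) + a)%MM) -> forall a, P a.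
Proof.
move=> P0 PU a; elim/ltn_ind: {a}(mdeg a) {-2}a (erefl (mdeg a)) => e IH a ae.
have [[i ai]|a0] := pselect (exists i, a i != 0%N); last first.
  suff -> : a = 0%MM by [].
  apply/mnmP => i; rewrite mnm0E; apply/eqP/negPn/negP => ai.
  by apply: a0; exists i.
have aE : (U_(i) + (a - U_(i)) = a)%MM by rewrite addmC submK ?lep1mP.
rewrite -aE; apply/PU/(IH _ _ _ erefl).
by rewrite -ae -[in leqRHS]aE mdegD mdeg1.
Qed.

Section Pairings.
Context {R : realType}.

Lemma pairing_lin m d c (p q : {mpoly R[m]}) (y : tmvec R m d) :
  pairing (c *: p + q) y = c * pairing p y + pairing q y.
Proof.
rewrite /pairing mulr_sumr -big_split; apply: eq_bigr => a _ /=.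
by rewrite mcoeffD mcoeffZ mulrDl mulrA.
Qed.

Lemma pairingD m d (p q : {mpoly R[m]}) (y : tmvec R m d) :
  pairing (p + q) y = pairing p y + pairing q y.
Proof. by rewrite -[p in LHS]scale1r pairing_lin mul1r. Qed.

Lemma pairingZ m d c (p : {mpoly R[m]}) (y : tmvec R m d) :
  pairing (c *: p) y = c * pairing p y.
Proof.
rewrite /pairing mulr_sumr; apply: eq_bigr => a _.
by rewrite mcoeffZ mulrA.
Qed.

Lemma pairingB m d (p q : {mpoly R[m]}) (y : tmvec R m d) :
  pairing (p - q) y = pairing p y - pairing q y.
Proof. by rewrite addrC -scaleN1r pairing_lin mulN1r addrC. Qed.

Lemma pairing_sum m d I (r : seq I) (P : pred I) (F : I -> {mpoly R[m]})
    (y : tmvec R m d) :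
  pairing (\sum_(i <- r | P i) F i) y = \sum_(i <- r | P i) pairing (F i) y.
Proof.
rewrite /pairing exchange_big /=; apply: eq_bigr => a _.
by rewrite raddf_sum mulr_suml.
Qed.

Lemma pairingX m d (y : tmvec R m d) (a : monom_le m d) :
  pairing 'X_[bmnm a] y = y a.
Proof.
rewrite /pairing (bigD1 a) //= mcoeffX eqxx mul1r big1 ?addr0 // => b ba.
by rewrite mcoeffX -[_ == _]/(a == b) eq_sym (negPf ba) mul0r.
Qed.

Lemma hpairing_lin n d c (p q : {mpoly R[n]}) (y : hmvec R n d) :
  hpairing (c *: p + q) y = c * hpairing p y + hpairing q y.
Proof.
rewrite /hpairing mulr_sumr -big_split; apply: eq_bigr => a _ /=.
by rewrite mcoeffD mcoeffZ mulrDl mulrA.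
Qed.

Lemma hpairingX n d (y : hmvec R n d) (b : monom_eq n d) :
  hpairing 'X_[expo b] y = y b.
Proof.
rewrite /hpairing (bigD1 b) //= mcoeffX eqxx mul1r big1 ?addr0 // => c cb.
suff /negPf bc : expo b != expo c by rewrite mcoeffX bc mul0r.
by apply: contraNneq cb => bc; apply/eqP; do 2!apply: val_inj.
Qed.

End Pairings.

Section Degrees.
Context {R : realType} {m : nat}.

Lemma msize_sum_vars_co : (msize (1 - sum_vars m : {mpoly R[m]}) <= 2)%N.
Proof.
rewrite (leq_trans (mmeasureD_le _ _ _)) // geq_max msize1 mmeasureN /=.
rewrite (leq_trans (mmeasure_sum _ _ _ _)) //; apply/bigmax_leqP => i _.
by rewrite msizeX mdeg1.
Qed.

Lemma msize_sqnorm_co : (msize (1 - sqnorm_vars m : {mpoly R[m]}) <= 3)%N.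
Proof.
rewrite (leq_trans (mmeasureD_le _ _ _)) // geq_max msize1 mmeasureN /=.
rewrite (leq_trans (mmeasure_sum _ _ _ _)) //; apply/bigmax_leqP => i _.
by rewrite mpolyXn msizeX mdegMn mdeg1.
Qed.

End Degrees.

Section Relaxation.
Context {R : realType} {m k : nat}.
Implicit Types (z : tmvec R m (2 * k)) (q a : {mpoly R[m]}).

(** The number [e] bounds half the degree of [q]; stating the degree
    condition with it avoids exact degrees. *)
Lemma localized_sqr_ge0 z q a e : psdmx (loc_mx q z) ->
  (msize q <= e.*2.+1)%N -> (msize a + e <= k.+1)%N ->
  0 <= pairing (q * a ^+ 2) z.
Proof.
move=> [_ psd] qe ak; rewrite loc_mxP; first exact: psd.
rewrite /loc_order; lia.
Qed.

Lemma psd_of_localized_sqr z q :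
  (forall a, (msize a <= (loc_order k q).+1)%N -> 0 <= pairing (q * a ^+ 2) z) ->
  psdmx (loc_mx q z).
Proof.
move=> sqr0; split=> [|v]; first exact: loc_mx_sym.
pose a : {mpoly R[m]} := \sum_i v i 0 *: 'X_[monom_at i].
have -> : v = vec_coef (loc_order k q) a.
  apply/colP => i; rewrite mxE raddf_sum (bigD1 i) //= mcoeffZ mcoeffX eqxx mulr1.
  rewrite big1 ?addr0 // => j ji; rewrite mcoeffZ mcoeffX.
  suff /negPf -> : monom_at j != monom_at i by rewrite mulr0.
  by apply: contraNneq ji => ji; apply/eqP/enum_val_inj/val_inj.
have a_le : (msize a <= (loc_order k q).+1)%N.
  rewrite (leq_trans (mmeasure_sum _ _ _ _)) //; apply/bigmax_leqP => i _.
  by rewrite (leq_trans (msizeZ_le _ _)) // msizeX; exact: bmdeg.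
by rewrite -loc_mxP // sqr0.
Qed.

(** The ball constraint gives [x_i^2 h^2 <= h^2], so the variables of [a] can
    be removed one at a time. *)
Lemma moment_sqr_le z (a : 'X_{1..m}) : psdmx (loc_mx 1 z) ->
  psdmx (loc_mx (1 - sqnorm_vars m) z) -> (mdeg a <= k)%N ->
  pairing ('X_[a] ^+ 2) z <= pairing 1 z.
Proof.
move=> psd1 psdN; have sqr0 p : (msize p <= k.+1)%N -> 0 <= pairing (p ^+ 2) z.
  by move=> pk; rewrite -[p ^+ 2]mul1r (localized_sqr_ge0 (e := 0)) ?msize1 ?addn0.
elim/multinom_ind: a => [|i a IH]; first by rewrite mpolyX0 expr1n.
rewrite mdegD mdeg1 => ak; apply: le_trans (IH _); last by lia.
have : 0 <= pairing ((1 - sqnorm_vars m) * 'X_[a] ^+ 2) z.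
  apply: (localized_sqr_ge0 (e := 1)) => //; first exact: msize_sqnorm_co.
  by rewrite msizeX; lia.
rewrite mulrBl mul1r mulr_suml (bigD1 i) //= -exprMn -mpolyXD.
rewrite pairingB pairingD pairing_sum.
set S := \sum_(_ <- _ | _) _; suff : 0 <= S by lra.
apply: sumr_ge0 => j _; rewrite -exprMn -mpolyXD; apply: sqr0.
by rewrite msizeX mdegD mdeg1; lia.
Qed.

(** Positivity on the squares of [1 + 'X_[a]] and [1 - 'X_[a]]. *)
Lemma moment_le z (a : 'X_{1..m}) : psdmx (loc_mx 1 z) ->
  psdmx (loc_mx (1 - sqnorm_vars m) z) -> (mdeg a <= k)%N ->
  `|pairing 'X_[a] z| <= pairing 1 z.
Proof.
move=> psd1 psdN ak; have := moment_sqr_le psd1 psdN ak.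
have sqr0 (s : R) : 0 <= pairing (1 * (s *: 'X_[a] + 1) ^+ 2) z.
  apply: (localized_sqr_ge0 (e := 0)) => //; first by rewrite msize1.
  rewrite addn0 (leq_trans (mmeasureD_le _ _ _)) // geq_max msize1 /= andbT.
  by rewrite (leq_trans (msizeZ_le _ _)) // msizeX.
have sqrE s : pairing (1 * (s *: 'X_[a] + 1) ^+ 2) z =
    s ^+ 2 * pairing ('X_[a] ^+ 2) z + (2 * s * pairing 'X_[a] z + pairing 1 z).
  rewrite -!pairing_lin; congr pairing.
  by rewrite mul1r sqrrD mulr1 expr1n exprZn -scaler_nat scalerA addrA.
have := sqr0 1; have := sqr0 (-1); rewrite !sqrE => ? ? ?.
by rewrite ler_norml; apply/andP; split; lra.
Qed.

End Relaxation.

Section LimitFunctional.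
Context {R : realType}.

Lemma loc_nneg_prodX (A : comAlgType R) (L : {scalar A}) I (r : seq I) (F : I -> A)
    (e : I -> nat) : loc_nneg L 1 ->
  (forall i, loc_nneg L (F i) /\ loc_nneg L (1 - F i)) ->
  loc_nneg L (\prod_(i <- r) F i ^+ e i).
Proof.
move=> p1 pF; elim: r => [|i r IH]; first by rewrite big_nil.
rewrite big_cons; elim: (e i) => [|k IHk]; first by rewrite mul1r.
by rewrite exprS -mulrA; apply: loc_nnegM => //; case: (pF i).
Qed.

Lemma limit_functional m (z : forall k, tmvec R m (2 * k)) :
  (forall a : 'X_{1..m}, ev_bounded (fun k => pairing 'X_[a] (z k))) ->
  exists L : {scalar {mpoly R[m]}},
    forall p, ev_bounded (fun k => pairing p (z k)) /\
              L p = ulim (fun k => pairing p (z k)).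
Proof.
move=> bX; have bp p : ev_bounded (fun k => pairing p (z k)).
  rewrite [p]mpolyE; under eq_fun do rewrite pairing_sum.
  apply: (ulim_sum _ _).1 => a; under eq_fun do rewrite pairingZ.
  by apply: ev_boundedM => //; exact: ev_bounded_cst.
pose L p := ulim (fun k => pairing p (z k)).
have Llin : linear_for *%R L.
  by move=> c p q; rewrite /L; under eq_fun do rewrite pairing_lin; exact: ulim_lin.
pose Ll : {scalar {mpoly R[m]}} :=
  HB.pack L (GRing.isLinear.Build R {mpoly R[m]} R *%R L Llin).
by exists Ll => p.
Qed.

(** The functional of the full moment problem, as the limit of the truncated
    ones.  A condition on a fixed polynomial [q h^2] is available from some
    order on, hence it holds in the limit. *)
Lemma simplex_functional m d (y : tmvec R m d) : (0 < d)%N ->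
  (forall k, (uphalf d <= k)%N -> @F_simplex R m.+1 d k y) ->
  exists L : {scalar {mpoly R[m]}},
    [/\ loc_nneg L 1, forall i, loc_nneg L 'X_i, loc_nneg L (1 - sum_vars m) &
        forall a : monom_le m d, L 'X_[bmnm a] = y a].
Proof.
move=> d0 Fy.
have ex_z k : exists z : tmvec R m (2 * k), (uphalf d <= k)%N ->
    @S_simplex R m.+1 k z /\ forall (a : monom_le m d) (b : monom_le m (2 * k)),
      bmnm a = bmnm b -> y a = z b.
  have [dk|kd] := leqP (uphalf d) k; last by exists 0.
  by have [z zS zy] := Fy k dk; exists z.
pose z k := sval (cid (ex_z k)).
have zP k : (uphalf d <= k)%N -> @S_simplex R m.+1 k (z k) /\
    forall (a : monom_le m d) (b : monom_le m (2 * k)),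
      bmnm a = bmnm b -> y a = z k b.
  exact: svalP (cid (ex_z k)).
have zX k (a : monom_le m d) : (uphalf d <= k)%N -> pairing 'X_[bmnm a] (z k) = y a.
  move=> dk; have lt : (mdeg (bmnm a) < (2 * k).+1)%N.
    by have := bmdeg a; lia.
  rewrite -[bmnm a]/(bmnm (BMultinom lt)) pairingX; apply/esym.
  exact: (zP k dk).2.
pose y0 := y (BMultinom (bm0_proof m d)).
have bX a : ev_bounded (fun k => pairing 'X_[a] (z k)).
  exists y0, (uphalf d + mdeg a)%N => k ak; have dk : (uphalf d <= k)%N by lia.
  have [[psd1 _ _ psdN] _] := zP k dk.
  rewrite /y0 -(zX k) //= mpolyX0; apply: moment_le => //; lia.
have [L LE] := limit_functional bX; exists L.
have nnegL q e : (msize q <= e.*2.+1)%N ->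
    (forall k, (uphalf d <= k)%N -> psdmx (loc_mx q (z k))) -> loc_nneg L q.
  move=> qe psd h; have [b ->] := LE (q * h ^+ 2); apply: ulim_ge0 => //.
  exists (uphalf d + (msize h + e))%N => k hk.
  apply: (localized_sqr_ge0 (e := e)) => //.
    exact/psd/(leq_trans (leq_addr _ _) hk).
  by rewrite (leq_trans _ (leqW hk)) // leq_addl.
split=> [|i||a].
- by apply: (nnegL _ 0%N); rewrite ?msize1 // => k /zP[[]].
- by apply: (nnegL _ 1%N); rewrite ?msizeX ?mdeg1 // => k /zP[[]].
- apply: (nnegL _ 1%N) => [|k /zP[[]]//].
  exact: leq_trans msize_sum_vars_co _.
- have [_ ->] := LE 'X_[bmnm a]; apply: (ulim_cvg _).2 => e e0.
  by exists (uphalf d) => k dk; rewrite zX // subrr normr0 ltW.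
Qed.

End LimitFunctional.

Section Dehomogenized.
Context {R : realType} {m d : nat}.

(** The vector [varpi_invT y] gives [y] on the forms [xbar^c (e.x)^r].  These
    span all forms of degree [d]: a factor [x_n] equals [e.x] minus the other
    variables, so an induction on the exponent of [x_n] reaches every
    monomial. *)
Lemma varpi_invT_form (L : {scalar {mpoly R[m]}}) (y : hmvec R m.+1 d) :
  (forall a : monom_le m d, L 'X_[bmnm a] = varpi_invT y a) ->
  forall b : monom_eq m.+1 d, y b = L (varpi 'X_[expo b]).
Proof.
move=> LE; have varpiM (p q : {mpoly R[m.+1]}) : varpi (p * q) = varpi p * varpi q.
  exact: rmorphM.
have varpiX (p : {mpoly R[m.+1]}) e : varpi (p ^+ e) = varpi p ^+ e by exact: rmorphXn.
pose last_var : {mpoly R[m.+1]} := 'X_ord_max.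
pose emb : 'I_m -> 'I_m.+1 := @embed m.+1.
pose xbar c : {mpoly R[m.+1]} := @xbar_monom R m.+1 c.
have embE i : widen_ord (leqnSn m) i = emb i by exact: val_inj.
have sumE : sum_vars m.+1 = \sum_(i < m) 'X_(emb i) + last_var.
  by rewrite /sum_vars big_ord_recr /=; congr (_ + _); apply: eq_bigr => i _;
     rewrite embE.
have xbarU i c : xbar (U_(i) + c)%MM = 'X_(emb i) * xbar c.
  rewrite /xbar /xbar_monom (bigD1 i) //= [in RHS](bigD1 i) //= mulrA.
  rewrite mnmDE mnm1E eqxx exprS; congr (_ * _); apply: eq_bigr => i' ni.
  by rewrite mnmDE mnm1E eq_sym (negPf ni).
have varpi_xbar c : varpi (xbar c) = 'X_[c].
  rewrite mpolyXE_id /varpi rmorph_prod; apply: eq_bigr => i _.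
  by rewrite rmorphXn; congr (_ ^+ _); exact: varpi_embed.
pose p_ c j r := xbar c * last_var ^+ j * sum_vars m.+1 ^+ r.
have p_S c j r : p_ c j.+1 r = p_ c j r.+1 - \sum_(i < m) p_ (U_(i) + c)%MM j r.
  rewrite /p_; under eq_bigr do rewrite xbarU -!mulrA.
  rewrite -mulr_suml !exprS.
  have -> : last_var = sum_vars m.+1 - \sum_(i < m) 'X_(emb i).
    by rewrite sumE addrC addKr.
  ring.
pose H : {scalar {mpoly R[m.+1]}} := HB.pack (fun p => hpairing p y)
  (GRing.isLinear.Build R {mpoly R[m.+1]} R *%R (fun p => hpairing p y)
     (fun c p q => hpairing_lin c p q y)).
have varpiB (p q : {mpoly R[m.+1]}) : varpi (p - q) = varpi p - varpi q.
  exact: raddfB.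
have varpi_sum (F : 'I_m -> {mpoly R[m.+1]}) :
    varpi (\sum_i F i) = \sum_i varpi (F i) by exact: raddf_sum.
have key j : forall c r, (mdeg c + j + r)%N = d -> H (p_ c j r) = L (varpi (p_ c j r)).
  elim: j => [|j IH] c r cd.
    have ltc : (mdeg c < d.+1)%N by lia.
    rewrite /p_ mulr1 varpiM varpiX varpi_sum_vars // expr1n mulr1 varpi_xbar.
    rewrite (LE (BMultinom ltc)) ffunE /=.
    by have -> : r = (d - mdeg c)%N by lia.
  have sumIH : \sum_(i < m) H (p_ (U_(i) + c)%MM j r) =
      L (varpi (\sum_(i < m) p_ (U_(i) + c)%MM j r)).
    rewrite varpi_sum [RHS]linear_sum; apply: eq_bigr => i _.
    by rewrite IH // mdegD mdeg1; lia.
  rewrite p_S varpiB; transitivity (H (p_ c j r.+1) -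
    \sum_(i < m) H (p_ (U_(i) + c)%MM j r)).
    by rewrite linearB; congr (_ + - _); exact: linear_sum.
  by rewrite sumIH IH ?linearB //; lia.
move=> b; pose c : 'X_{1..m} := [multinom expo b (emb i) | i < m].
have bE : 'X_[expo b] = p_ c (expo b ord_max) 0.
  rewrite /p_ mulr1 mpolyXE_id big_ord_recr; congr (_ * _); apply: eq_bigr => i _.
  by rewrite mnmE embE.
rewrite -hpairingX bE; apply: key.
have bd : mdeg (expo b) = d by apply/eqP; exact: (valP b).
rewrite addn0 -[RHS]bd !mdegE big_ord_recr; congr (_ + _)%N.
by apply: eq_bigr => i _; rewrite mnmE embE.
Qed.

(** The barycentric coordinates lie between 0 and 1 in the eyes of the limit
    functional, which is therefore nonnegative on their products; these are
    the images of the monomials in [x], so de Finetti applies. *)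
Theorem relaxations_sub_CP (y : hmvec R m.+1 d) : (0 < d)%N ->
  (forall k, (uphalf d <= k)%N -> H_simplex R m.+1 d k y) -> CP_vec R m.+1 d y.
Proof.
move=> d0 Hy; have [L [pos1 posX posS LE]] := simplex_functional d0 Hy.
pose vp : {mpoly R[m.+1]} -> {mpoly R[m]} := @varpi R m.+1.
pose Lam : {scalar {mpoly R[m.+1]}} := HB.pack (fun p => L (vp p))
  (GRing.isLinear.Build R {mpoly R[m.+1]} R *%R (fun p => L (vp p))
     (fun c p q => etrans (congr1 L (linearP _ c p q)) (linearP L c _ _))).
have -> : y = [ffun b => Lam 'X_[expo b]].
  by apply/ffunP => b; rewrite ffunE; exact: varpi_invT_form.
apply: de_finetti_CP => // [a|p]; last first.
  have vpM q : vp (q * p) = vp q * vp p by exact: rmorphM.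
  have vp_sum : vp (sum_vars m.+1) = 1 by rewrite /vp varpi_sum_vars.
  by rewrite -[LHS]/(L (vp _)) vpM vp_sum mul1r.
(* the barycentric coordinates add up to 1, so each of them is at most 1 *)
have sum_le1 i : 1 - 'X_i = (1 - sum_vars m) + \sum_(j | j != i) 'X_j :> {mpoly R[m]}.
  by rewrite /sum_vars (bigD1 i) //=; ring.
have nneg0 : loc_nneg L 0 by move=> h; rewrite mul0r linear0.
have posF (c : 'I_m.+1) : loc_nneg L (vp 'X_c) /\ loc_nneg L (1 - vp 'X_c).
  have nneg_sum (P : pred 'I_m) : loc_nneg L (\sum_(j | P j) 'X_j).
    by apply: (big_ind (loc_nneg L)) => //; exact: loc_nnegD.
  rewrite /vp /varpi comp_mpolyXU -tnth_nth tnth_mktuple.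
  case: insubP => [i _ _|_]; split=> //=.
    by rewrite sum_le1; exact: loc_nnegD.
  by rewrite opprB addrC subrK; exact: nneg_sum.
suff /(_ 1) : loc_nneg L (vp 'X_[a]) by rewrite expr1n mulr1.
rewrite mpolyXE_id /vp /varpi rmorph_prod; under eq_bigr do rewrite rmorphXn.
exact: loc_nneg_prodX.
Qed.

End Dehomogenized.

(** * Points of the cone satisfy the relaxations *)

Section Converse.
Context {R : realType}.

Definition moments m e (v : 'I_m -> R) : tmvec R m e :=
  [ffun a => \prod_i v i ^+ bmnm a i].

Lemma pairing_moments m e (v : 'I_m -> R) (p : {mpoly R[m]}) :
  (msize p <= e.+1)%N -> pairing p (moments e v) = p.@[v].
Proof.
move=> pe; rewrite [in RHS](mpolywE pe) raddf_sum; apply: eq_bigr => a _.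
by rewrite /= mevalZ mevalX ffunE.
Qed.

Lemma hpairing_hom_power n d (u : 'rV[R]_n) (p : {mpoly R[n]}) :
  p \is d.-homog -> hpairing p (hom_power d u) = p.@[u 0].
Proof.
move=> p_hom; have pd : (msize p <= d.+1)%N.
  by rewrite msizeE; apply/bigmax_leqP_seq => a ap _; rewrite (dhomog_mf p_hom ap).
rewrite [in RHS](mpolywE pd) raddf_sum /= (bigID (fun a => mdeg (bmnm a) == d)) /=.
rewrite [X in _ + X]big1 => [|a ad]; last first.
  by rewrite (dhomog_nemf_coeff p_hom ad) scale0r raddf0.
rewrite addr0 (big_sub (fun a : monom_le n d => mdeg (bmnm a) == d)).
by apply: eq_bigr => a _; rewrite mevalZ mevalX ffunE.
Qed.

Lemma hpairing_sum n d I (r : seq I) (F : I -> hmvec R n d) (p : {mpoly R[n]}) :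
  hpairing p (\sum_(i <- r) F i) = \sum_(i <- r) hpairing p (F i).
Proof.
rewrite /hpairing exchange_big; apply: eq_bigr => a _.
by rewrite sum_ffunE mulr_sumr.
Qed.

Lemma msizeM_leq m (p q : {mpoly R[m]}) :
  (msize (p * q) <= (msize p + msize q).-1)%N.
Proof.
have [->|p0] := eqVneq p 0; first by rewrite mul0r msize0.
have [->|q0] := eqVneq q 0; first by rewrite mulr0 msize0.
by rewrite msizeM.
Qed.

Lemma S_simplex_moments m k I (r : seq I) (w : I -> R) (v : I -> 'I_m -> R) :
  (0 < k)%N -> (forall t, 0 <= w t) -> (forall t i, 0 <= v t i) ->
  (forall t, \sum_i v t i <= 1) ->
  @S_simplex R m.+1 k [ffun a => \sum_(t <- r) w t * moments (2 * k) (v t) a].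
Proof.
move=> k0 w0 v0 v1; set z := [ffun _ => _].
have psd q : (uphalf (msize q).-1 <= k)%N -> (forall t, 0 <= q.@[v t]) ->
    psdmx (loc_mx q z).
  move=> qk q0; apply: psd_of_localized_sqr => a; rewrite /loc_order => ak.
  have qa : (msize (q * a ^+ 2) <= (2 * k).+1)%N.
    have := msizeM_leq q (a ^+ 2); have := msizeM_leq a a; rewrite -expr2.
    lia.
  have -> : pairing (q * a ^+ 2) z =
      \sum_(t <- r) w t * pairing (q * a ^+ 2) (moments (2 * k) (v t)).
    rewrite /pairing; under eq_bigr do rewrite ffunE mulr_sumr.
    rewrite exchange_big; apply: eq_bigr => t _ /=.
    by rewrite mulr_sumr; apply: eq_bigr => b _; rewrite mulrCA.
  apply: sumr_ge0 => t _; rewrite pairing_moments // mevalM.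
  by rewrite mulr_ge0 // mulr_ge0 // rmorphXn sqr_ge0.
have v_le1 t i : v t i <= 1.
  by apply: le_trans (v1 t); rewrite (bigD1 i) //= lerDl sumr_ge0.
split=> [|i||]; apply: psd => [|t].
- by rewrite msize1.
- by rewrite meval1 ler01.
- by rewrite msizeX mdeg1.
- by rewrite mevalXU.
- have := @msize_sum_vars_co R m => /=; move: (mmeasure _ _) => e; lia.
- rewrite mevalB meval1 subr_ge0 /sum_vars raddf_sum /=.
  by under eq_bigr do rewrite mevalXU.
- have := @msize_sqnorm_co R m => /=; move: (mmeasure _ _) => e; lia.
- rewrite mevalB meval1 subr_ge0 /sqnorm_vars raddf_sum (le_trans _ (v1 t)) //.
  apply: ler_sum => i _; rewrite /= expr2 mevalM mevalXU.
  by rewrite ler_piMr.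
Qed.

Lemma dhomog_xbar_sum n (a : 'X_{1..n.-1}) e :
  (xbar_monom a * sum_vars n ^+ e : {mpoly R[n]}) \is (mdeg a + e).-homog.
Proof.
have homX i : ('X_i : {mpoly R[n]}) \is 1.-homog by rewrite dhomogX /= mdeg1.
apply: dhomogM; last by rewrite -[X in X.-homog]mul1n; apply/dhomogMn/rpred_sum.
rewrite mdegE; apply: (big_ind2 (fun (p : {mpoly R[n]}) e => p \is e.-homog)).
- exact: dhomog1.
- by move=> p e1 q e2; exact: dhomogM.
- by move=> i _; rewrite -[X in X.-homog]mul1n; exact: dhomogMn.
Qed.

(** With [s = e.u], the power of [u] has the moments of the point [ubar / s]
    with mass [s^d]. *)
Lemma CP_sub_relaxations m d k (y : hmvec R m.+1 d) : (0 < d)%N ->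
  (uphalf d <= k)%N -> CP_vec R m.+1 d y -> H_simplex R m.+1 d k y.
Proof.
move=> d0 dk [r [u [u0 ->]]].
pose s t := \sum_j u t 0 j.
have s0 t : 0 <= s t by exact: sumr_ge0.
pose v t (i : 'I_m) := u t 0 (@embed m.+1 i) / s t.
(* for [s t = 0] the point is [0 / 0 = 0], and [u t] vanishes as well *)
have uE t j : u t 0 j = s t * (u t 0 j / s t).
  have [st|st] := eqVneq (s t) 0; last by rewrite mulrC divfK.
  by rewrite st mul0r; apply: (psumr_eq0P (fun j _ => u0 t j) st).
exists [ffun a => \sum_t s t ^+ d * moments (2 * k) (v t) a].
  apply: S_simplex_moments => [|t|t i|t].
  - lia.
  - exact: exprn_ge0.
  - exact: divr_ge0.
  - rewrite /v -mulr_suml; have [st|st] := eqVneq (s t) 0.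
      by rewrite st invr0 mulr0 ler01.
    rewrite ler_pdivrMr ?mul1r ?lt0r ?st ?s0 // [leRHS]big_ord_recr /= ler_wpDr //.
    rewrite le_eqVlt; apply/orP; left; apply/eqP; apply: eq_bigr => i _.
    by congr (u t 0 _); apply: val_inj.
move=> a b ab; rewrite !ffunE hpairing_sum; apply: eq_bigr => t _.
rewrite hpairing_hom_power; last first.
  have ad := bmdeg a; rewrite -[X in X.-homog](subnKC (m := mdeg (bmnm a))) //.
  exact: dhomog_xbar_sum.
rewrite mevalM rmorphXn /= ffunE -ab.
have -> : (sum_vars m.+1).@[u t 0] = s t.
  by rewrite raddf_sum; apply: eq_bigr => j _; rewrite /= mevalXU.
rewrite /xbar_monom rmorph_prod /=.
under eq_bigr do rewrite rmorphXn /= mevalXU uE exprMn.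
rewrite big_split /= prodrXr -mdegE mulrAC -exprD subnKC //.
by have := bmdeg a; rewrite ltnS.
Qed.

End Converse.

(** * Tensors *)

Section Tensors.
Context {R : realType} {n d : nat}.

Lemma tuple_monom_deg (t : d.-tuple 'I_n) : mdeg (tuple_monom t) = d.
Proof.
have := congr1 (fun p : {mpoly R[n]} => msize p) (@tuple_monomX R n d t).
rewrite -(big_morph _ (@mpolyXD n R) (mpolyX0 _ _)) !msizeX => -[->].
rewrite mdeg_sum; under eq_bigr do rewrite mdeg1.
by rewrite sum_nat_const card_ord muln1.
Qed.

(** Every entry of a tensor is read by [phi] at the exponent of its index. *)
Lemma phi_inj : injective (@phi R n d).
Proof.
move=> A B AB; apply/val_inj/ffunP => t.
have lt : (mdeg (tuple_monom t) < d.+1)%N by rewrite tuple_monom_deg.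
have td : mdeg (bmnm (BMultinom lt)) == d by rewrite /= tuple_monom_deg.
have tE : tuple_monom t = expo (exist _ (BMultinom lt) td : monom_eq n d) by [].
by rewrite -[LHS](phiE A tE) AB (phiE B tE).
Qed.

Lemma phiD (A B : sym_tensor R n d) : phi (A + B) = phi A + phi B.
Proof.
apply/ffunP => b; rewrite !ffunE; case: pickP => [t _|_]; last by rewrite addr0.
by rewrite ffunE.
Qed.

Lemma phi_sum I (r : seq I) (F : I -> sym_tensor R n d) :
  phi (\sum_(i <- r) F i) = \sum_(i <- r) phi (F i).
Proof.
have phi0 : phi (0 : sym_tensor R n d) = 0.
  by apply: (addrI (phi 0)); rewrite -phiD !addr0.
exact: (big_morph _ phiD phi0).
Qed.

Lemma exists_tuple_monom (b : monom_eq n d) :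
  exists t : d.-tuple 'I_n, tuple_monom t = expo b.
Proof.
have [s [size_s sP]] : exists s : seq 'I_n,
    size s = mdeg (expo b) /\ forall i, count_mem i s = expo b i.
  elim/multinom_ind: (expo b) => [|j a [s [size_s sa]]].
    by exists [::]; rewrite mdeg0; split=> // i; rewrite mnm0E.
  exists (j :: s); rewrite mdegD mdeg1 -size_s; split=> // i.
  by rewrite /= sa mnmDE mnm1E.
have size_sd : size s == d by rewrite size_s; exact: (valP b).
by exists (Tuple size_sd); apply/mnmP => i; rewrite mnmE -sP.
Qed.

Lemma phi_tensor_power (u : 'rV[R]_n) : phi (tensor_power d u) = hom_power d u.
Proof.
apply/ffunP => b; have [t tb] := exists_tuple_monom b; rewrite (phiE _ tb) !ffunE.
have := congr1 (fun p : {mpoly R[n]} => p.@[u 0]) (@tuple_monomX R n d t).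
rewrite tb mevalX rmorph_prod /= => ->.
by apply: eq_bigr => j _; rewrite mevalXU.
Qed.

Lemma phi_CP : (@phi R n d @^-1` CP_vec R n d = CP_tensor R n d)%classic.
Proof.
apply/seteqP; split=> [A [r [u [u0 phiA]]]|A [r [u [u0 ->]]]];
  exists r, u; split=> //.
  apply: phi_inj; rewrite phiA phi_sum.
  by apply: eq_bigr => i _; rewrite phi_tensor_power.
by rewrite phi_sum; apply: eq_bigr => i _; rewrite phi_tensor_power.
Qed.

End Tensors.

Local Open Scope classical_set_scope.

Theorem theorem3p2 (R : realType) (n d : nat) (hn : (2 <= n)%N) (hd : (1 <= d)%N) :
  \bigcap_(k in [set k : nat | (uphalf d <= k)%N]) H_simplex R n d k
    = CP_vec R n d /\
  \bigcap_(k in [set k : nat | (uphalf d <= k)%N])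
      (@phi R n d @^-1` H_simplex R n d k)
    = CP_tensor R n d.
Proof.
have eqCP : \bigcap_(k in [set k : nat | (uphalf d <= k)%N]) H_simplex R n d k
    = CP_vec R n d.
  case: n hn => // m _; apply/seteqP; split=> y Hy.
    exact: relaxations_sub_CP.
  by move=> k dk; exact: CP_sub_relaxations.
by rewrite -preimage_bigcap eqCP phi_CP.
Qed.
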